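(* For every integer partition $\lambda$, $b_\lambda(-1)$ equals the number of standard tableaux $T$ of shape $\lambda$ for which $c(T)$ is odd. In particular, $b_\lambda(-1)>0$ for every non-empty partition $\lambda$.
   Context: For a standard tableau $T$ of shape $\lambda=(\lambda_1,\dots,\lambda_m)$ (filling by $1,\dots,|\lambda|$ with rows and columns increasing) and $2\le j\le\lambda_i$, $c_{ij}(T)=\#\{i'\ge i:\text{cell }(i',j-1)\text{ exists and }T_{i',j-1}<T_{ij}\}$, $c(T)=\prod_i\prod_{j=2}^{\lambda_i}c_{ij}(T)$, $c_q(T)=\prod_i\prod_{j=2}^{\lambda_i}[c_{ij}(T)]_q$ with $[a]_q=1+q+\dots+q^{a-1}$, and $b_\lambda(q)=\sum_T c_q(T)$ over standard tableaux $T$ of shape $\lambda$. *)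

(* Defs.v *)
From mathcomp Require Import all_boot all_order all_algebra.

Set Implicit Arguments.
Unset Strict Implicit.
Unset Printing Implicit Defensive.

Import GRing.Theory.
Local Open Scope ring_scope.

Definition is_partition (la : seq nat) : bool :=
  sorted geq la && (0%N \notin la).

(* Rows and columns are numbered from 0, so "j >= 2" reads "0 < cell_col x". *)
Definition cell (la : seq nat) : finType :=
  {i : 'I_(size la) & 'I_(nth 0%N la i)}.

Definition cell_row (la : seq nat) (x : cell la) : nat := tag x.
Definition cell_col (la : seq nat) (x : cell la) : nat := tagged x.

Definition filling (la : seq nat) : finType :=
  {ffun cell la -> 'I_(sumn la)}.

(* 'I_n is {0, ..., n - 1}; the shift makes the entries range over 1, ..., n. *)
Definition entry (la : seq nat) (T : filling la) (x : cell la) : nat :=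
  (T x).+1.

Definition standard (la : seq nat) (T : filling la) : bool :=
  [&& [forall k : 'I_(sumn la), #|[set x : cell la | entry T x == k.+1]| == 1%N],
      [forall x : cell la, forall y : cell la,
        (cell_row x == cell_row y) && (cell_col x < cell_col y)%N ==> (entry T x < entry T y)%N]
    & [forall x : cell la, forall y : cell la,
        (cell_col x == cell_col y) && (cell_row x < cell_row y)%N ==> (entry T x < entry T y)%N]].

Definition c_cell (la : seq nat) (T : filling la) (x : cell la) : nat :=
  #|[set y : cell la | [&& (cell_row x <= cell_row y)%N, (cell_col y).+1 == cell_col x
                         & (entry T y < entry T x)%N]]|.

Definition c_tab (la : seq nat) (T : filling la) : nat :=
  (\prod_(x : cell la | (0 < cell_col x)%N) c_cell T x)%N.

Definition qint (a : nat) : {poly int} := \sum_(k < a) 'X^k.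

Definition cq_tab (la : seq nat) (T : filling la) : {poly int} :=
  \prod_(x : cell la | (0 < cell_col x)%N) qint (c_cell T x).

Definition b_poly (la : seq nat) : {poly int} :=
  \sum_(T : filling la | standard T) cq_tab T.

(* Main.v *)
Require Import Defs.
From mathcomp Require Import all_boot all_order all_algebra.

Set Implicit Arguments.
Unset Strict Implicit.
Unset Printing Implicit Defensive.

Import GRing.Theory.
Local Open Scope ring_scope.

(** At [q = -1] the [q]-integer [[a]_q] is [1] if [a] is odd and [0] if [a] is
    even, so each tableau contributes the indicator of [c(T)] being odd.  For
    positivity, fill the diagram row by row: below row [i] every entry exceeds
    the entries of row [i], so every [c_ij] equals [1]. *)

Lemma horner_qintN1 (a : nat) : (qint a).[-1] = (odd a)%:R.
Proof.
rewrite /qint horner_sum; elim: a => [|a IHa]; first by rewrite big_ord0.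
rewrite big_ord_recr /= IHa hornerXn -signr_odd.
by case: (odd a); rewrite /= ?expr1 ?expr0 ?subrr ?add0r.
Qed.

Lemma horner_cq_tabN1 (la : seq nat) (T : filling la) :
  (cq_tab T).[-1] = (odd (c_tab T))%:R.
Proof.
rewrite /cq_tab /c_tab horner_prod.
(* Both products run over the same cells, and a product is odd exactly when every factor is. *)
apply: (big_rec2 (fun (x : int) (n : nat) => x = (odd n)%:R)) => // x n y _ ->.
by rewrite horner_qintN1 oddM -natrM mulnb.
Qed.

Lemma horner_b_polyN1 (la : seq nat) :
  (b_poly la).[-1] = #|[set T : filling la | standard T && odd (c_tab T)]|%:Z.
Proof.
rewrite /b_poly horner_sum -sum1dep_card -[RHS]natz natr_sum.
(* The parity condition moves from the index set into the summand, as a value 0 or 1. *)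
rewrite [RHS]big_mkcondr /=; apply: eq_bigr => T _.
by rewrite horner_cq_tabN1; case: (odd _).
Qed.

Lemma card_cell (la : seq nat) : #|cell la| = sumn la.
Proof.
rewrite card_tagged sumnE big_map big_enum /= sumnE (big_nth 0%N) big_mkord.
by apply: eq_bigr => i _; rewrite card_ord.
Qed.

Section RowReading.

Variable la : seq nat.

(** Position of [x], counted from 0, when the rows are read from top to bottom and each row from
    left to right. *)
Definition row_reading_index (x : cell la) : nat :=
  (sumn (take (cell_row x) la) + cell_col x)%N.

Lemma row_reading_index_ltS (x : cell la) :
  (row_reading_index x < sumn (take (cell_row x).+1 la))%N.
Proof.
case: x => i j; rewrite /row_reading_index /cell_row /cell_col /=.
by rewrite (take_nth 0%N) // sumn_rcons ltn_add2l.
Qed.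

Lemma leq_sumn_take (m n : nat) :
  (m <= n)%N -> (sumn (take m la) <= sumn (take n la))%N.
Proof.
by move=> lemn; rewrite -(subnKC lemn) takeD sumn_cat leq_addr.
Qed.

Lemma row_reading_index_lt_row (x y : cell la) :
  (cell_row x < cell_row y)%N ->
  (row_reading_index x < row_reading_index y)%N.
Proof.
move=> ltxy; apply: leq_trans (row_reading_index_ltS x) _.
exact: leq_trans (leq_sumn_take ltxy) (leq_addr _ _).
Qed.

Lemma row_reading_index_bound (x : cell la) :
  (row_reading_index x < sumn la)%N.
Proof.
apply: leq_trans (row_reading_index_ltS x) _.
by rewrite -[X in (_ <= sumn X)%N](take_size la) leq_sumn_take // ltn_ord.
Qed.

(** The type of the column depends on the row, so the row equality has to be eliminated before the
    columns can be compared. *)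
Lemma cell_inj (x y : cell la) :
  cell_row x = cell_row y -> cell_col x = cell_col y -> x = y.
Proof.
case: x y => [i j] [i' j']; rewrite /cell_row /cell_col /= => /val_inj ei.
by case: _ / ei j' => j' /val_inj ->.
Qed.

Definition row_reading_tableau : filling la :=
  [ffun x => Ordinal (row_reading_index_bound x)].

Lemma entry_row_reading (x : cell la) :
  entry row_reading_tableau x = (row_reading_index x).+1.
Proof. by rewrite /entry ffunE. Qed.

(** Distinct rows give strictly ordered positions; within one row the common offset cancels. *)
Lemma row_reading_index_inj : injective row_reading_index.
Proof.
move=> x y exy; have exy_row : cell_row x = cell_row y.
  by case: (ltngtP (cell_row x) (cell_row y)) => // /row_reading_index_lt_row;
    rewrite exy ltnn.
apply: cell_inj => //; move: exy.
by rewrite /row_reading_index exy_row => /addnI.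
Qed.

Lemma standard_row_reading : standard row_reading_tableau.
Proof.
apply/and3P; split.
- apply/forallP=> k.
  have inj : injective row_reading_tableau.
    by move=> x y /(congr1 val); rewrite !ffunE => /row_reading_index_inj.
  (* There are as many cells as values, so injectivity gives an inverse [g], and [g k] is the only
     cell with entry [k.+1]. *)
  have [|g _ gK] := inj_card_bij inj; first by rewrite card_ord card_cell.
  rewrite (_ : [set _ | _] = [set g k]) ?cards1 //.
  apply/setP=> x; rewrite !inE /entry eqSS.
  apply/eqP/eqP => [/val_inj <-|->]; last by rewrite gK.
  by apply: inj; rewrite gK.
- apply/forallP=> x; apply/forallP=> y; apply/implyP=> /andP[/eqP er ltc].
  by rewrite !entry_row_reading ltnS /row_reading_index er ltn_add2l.
- apply/forallP=> x; apply/forallP=> y; apply/implyP=> /andP[_ ltr].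
  by rewrite !entry_row_reading ltnS row_reading_index_lt_row.
Qed.

(** Only the left neighbour of [x] is counted: cells in lower rows carry larger entries. *)
Lemma c_cell_row_reading (x : cell la) :
  (0 < cell_col x)%N -> c_cell row_reading_tableau x = 1%N.
Proof.
case: x => i j; rewrite {1}/cell_col /= => j_gt0.
have ltj : (j.-1 < nth 0%N la i)%N by apply: leq_ltn_trans (leq_pred _) _.
(* [y] is the left neighbour of the given cell. *)
pose y : cell la := Tagged (fun i : 'I_(size la) => 'I_(nth 0%N la i)) (Ordinal ltj).
rewrite /c_cell; set A := [set _ | _]; suff -> : A = [set y] by rewrite cards1.
apply/setP=> z; rewrite !inE !entry_row_reading ltnS.
apply/and3P/eqP => [[lerow /eqP ecol ltidx]|->].
  apply: cell_inj; last by rewrite {2}/cell_col /= -[LHS]/(_.+1.-1) ecol.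
  apply/eqP; rewrite eqn_leq lerow andbT leqNgt.
  (* If [z] lay strictly below the row of [y], it would be read after the given cell, against
     [ltidx]. *)
  apply: contraL ltidx => ltrow; rewrite -leqNgt ltnW //.
  exact: row_reading_index_lt_row.
rewrite /row_reading_index /cell_row /cell_col /= ltn_add2l.
by split; rewrite ?prednK.
Qed.

Lemma c_tab_row_reading : c_tab row_reading_tableau = 1%N.
Proof. by apply: big1 => x; apply: c_cell_row_reading. Qed.

End RowReading.

Theorem theorem3p13 (la : seq nat) (hla : is_partition la) :
  (b_poly la).[-1] = #|[set T : filling la | standard T && odd (c_tab T)]|%:Z
  /\ (la <> [::] -> 0 < (b_poly la).[-1]).
Proof.
split=> [|_]; rewrite horner_b_polyN1 // ltz_nat.
apply/card_gt0P; exists (row_reading_tableau la).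
by rewrite inE standard_row_reading c_tab_row_reading.
Qed.
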